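(* Let $(X,\mu,\Gamma)$ be a diffusion Markov triple with function spaces $\mathcal{A}_0\subset\mathcal{A}$ and operator $L$ (all as specified in the context), and let $F\in C^\infty(\mathbb{R})$. Let $u\in\mathcal{A}$ be a stable weak solution of $Lu+F(u)=0$ in $X$. Then $$\int_X\Big(\Gamma_2(u)-\Gamma\big(\Gamma(u)^{1/2}\big)\Big)\varphi^2\,d\mu\le\int_X\Gamma(u)\,\Gamma(\varphi)\,d\mu$$ for every $\varphi\in\mathcal{A}_0$.
   Context: Diffusion Markov triple. $(X,\tau)$ is a Polish space endowed with a $\sigma$-finite Borel measure $\mu$ with full support, $\mathcal{A}_0$ is a class of real-valued measurable functions on $X$, and $\Gamma:\mathcal{A}_0\times\mathcal{A}_0\to\mathcal{A}_0$ (the carré du champ) is a symmetric bilinear map, such that: (1) $\mathcal{A}_0\subset L^1(\mu)$ is a vector space, dense in every $L^p(\mu)$, $1\le p<\infty$, closed under products, and $\Psi(f_1,\dots,f_k)\in\mathcal{A}_0$ whenever $f_1,\dots,f_k\in\mathcal{A}_0$, $\Psi\in C^\infty(\mathbb{R}^k)$, $\Psi(0)=0$. (2) $\Gamma(f):=\Gamma(f,f)\ge 0$ for $f\in\mathcal{A}_0$, and for $f_1,\dots,f_k,g\in\mathcal{A}_0$ and $\Psi\in C^\infty(\mathbb{R}^k)$ with $\Psi(0)=0$, $\Gamma(\Psi(f_1,\dots,f_k),g)=\sum_{i=1}^k\partial_i\Psi(f_1,\dots,f_k)\Gamma(f_i,g)$ $\mu$-a.e. (3) For every $f\in\mathcal{A}_0$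 there is $C=C(f)>0$ with $|\int_X\Gamma(f,g)\,d\mu|\le C\|g\|_{L^2(\mu)}$ for every $g\in\mathcal{A}_0$. Set $\mathcal{E}(f,g):=\int_X\Gamma(f,g)\,d\mu$ on $\mathcal{A}_0\times\mathcal{A}_0$; $\mathcal{D}(\mathcal{E})$ is the completion of $\mathcal{A}_0$ for the norm $(\|f\|_{L^2(\mu)}^2+\mathcal{E}(f,f))^{1/2}$, and $\mathcal{E}$ and $\Gamma$ are extended to $\mathcal{D}(\mathcal{E})$ by continuity. (4) $L$ is the linear operator on $\mathcal{A}_0$ defined by $\int_X gLf\,d\mu=-\int_X\Gamma(f,g)\,d\mu$ for all $f,g\in\mathcal{A}_0$. Its domain $\mathcal{D}(L)$ is the set of $f\in\mathcal{D}(\mathcal{E})$ for which there is a constant $C>0$ with $|\mathcal{E}(f,g)|\le C\|g\|_{L^2(\mu)}$ for every $g\in\mathcal{D}(\mathcal{E})$; $L$ is extended to $\mathcal{D}(L)$ by the integration by parts formula against every $g\in\mathcal{D}(\mathcal{E})$ (and $L$ on $\mathcal{D}(L)$ is self-adjoint). (5) There is an increasing sequence $(\xi_k)_{k\ge1}\subset\mathcal{A}_0$ with $\xi_k(x)\in[0,1]$ for all $x\in X$, $\xi_k\to1$ $\mu$-a.e. in $X$, and $\Gamma(\xi_k)\le 1/k$ for $k\ge1$. There is also an algebra $\mathcal{A}\supset\mathcal{A}_0$ of measurable functions on $X$, containing the constants, such that: (1') if $f\in\mathcal{A}$ and $h\in\mathcal{A}_0$ then $hf\in\mathcal{A}_0$;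 (2') if $f\in\mathcal{A}$ and $\int_X hf\,d\mu\ge0$ for every positive $h\in\mathcal{A}_0$, then $f\ge0$; (3') if $f_1,\dots,f_k\in\mathcal{A}$ and $\Psi\in C^\infty(\mathbb{R}^k)$ with $\Psi(0)=0$, then $\Psi(f_1,\dots,f_k)\in\mathcal{A}$, and for $g\in\mathcal{A}$, $\Gamma(\Psi(f_1,\dots,f_k),g)=\sum_{i=1}^k\partial_i\Psi(f_1,\dots,f_k)\Gamma(f_i,g)$ $\mu$-a.e.; (4') $L:\mathcal{A}\to\mathcal{A}$ is an extension of $L$ on $\mathcal{A}_0$, and $\Gamma$ is defined on $\mathcal{A}\times\mathcal{A}$ by $\Gamma(f,g)=\frac12[L(fg)-fLg-gLf]\in\mathcal{A}$, with $\Gamma(f):=\Gamma(f,f)$; (5') $\Gamma(f)\ge0$ for every $f\in\mathcal{A}$; (6') for $f\in\mathcal{A}$, $g\in\mathcal{A}_0$, $\int_X\Gamma(f,g)\,d\mu=-\int_X gLf\,d\mu=-\int_X fLg\,d\mu$; (7') if $f\in\mathcal{A}$ and $\Gamma(f)=0$ then $f$ is constant. The carré du champ itéré is $\Gamma_2(f,g):=\frac12[L\Gamma(f,g)-\Gamma(f,Lg)-\Gamma(g,Lf)]$ for $f,g\in\mathcal{A}$, and $\Gamma_2(f):=\Gamma_2(f,f)$. $u$ is a weak solution of $Lu+F(u)=0$ in $X$ if $u\in\mathcal{A}$ and $\int_X\Gamma(u,\varphi)\,d\mu=\int_X F(u)\varphi\,d\mu$ for all $\varphi\in\mathcal{A}_0$.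 A weak solution $u$ is stable if $\int_X\Gamma(\varphi)\,d\mu-\int_X F'(u)\varphi^2\,d\mu\ge0$ for all $\varphi\in\mathcal{A}_0$. The expression $\Gamma(\Gamma(u)^{1/2})$ is understood via the chain rule: it equals $\Gamma(\Gamma(u))/(4\Gamma(u))$ on $\{\Gamma(u)\neq0\}$ and $0$ on $\{\Gamma(u)=0\}$. *)

(* Defs.v *)
From mathcomp Require Import all_boot all_order all_algebra.
From mathcomp Require Import all_classical all_reals all_analysis.

Set Implicit Arguments.
Unset Strict Implicit.
Unset Printing Implicit Defensive.
Import Order.TTheory GRing.Theory Num.Theory.
Import numFieldNormedType.Exports.

Local Open Scope classical_set_scope.
Local Open Scope ring_scope.

Notation borel X := (g_sigma_algebraType (@open X)).

Section topology.
Context {R : realType} (X : ptopologicalType).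

Definition polish : Prop := exists dist : X -> X -> R,
  [/\ [/\ forall x y, 0 <= dist x y,
          forall x y, dist x y = 0 <-> x = y,
          forall x y, dist x y = dist y x &
          forall x y z, dist x z <= dist x y + dist y z],
      forall (x : X) (U : set X),
        nbhs x U <-> exists2 e : R, 0 < e & [set y | dist x y < e] `<=` U,
      forall x_ : nat -> X,
        (forall e : R, 0 < e -> \forall m & n \near \oo, dist (x_ m) (x_ n) < e) ->
        exists x : X, x_ n @[n --> \oo] --> x &
      exists2 D : set X, countable D & dense D].

Definition full_support (mu : set X -> \bar R) : Prop :=
  forall U : set X, open U -> U !=set0 -> (0 < mu U)%E.

End topology.
Arguments polish R X : clear implicits.

Section smooth.
Context {R : realType}.

Fixpoint iter_partial (k : nat) (s : seq 'I_k) (Psi : 'rV[R]_k -> R) :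
    'rV[R]_k -> R :=
  if s is i :: s' then 'D_(delta_mx 0 i) (iter_partial s' Psi) else Psi.

(* All iterated partial derivatives, in any order, exist and are continuous. *)
Definition smooth_rV (k : nat) (Psi : 'rV[R]_k -> R) : Prop :=
  forall s : seq 'I_k,
    continuous (iter_partial s Psi) /\
    forall (i : 'I_k) (x : 'rV[R]_k),
      derivable (iter_partial s Psi) x (delta_mx 0 i).

Definition smooth (F : R -> R) : Prop :=
  forall (n : nat) (x : R), derivable (derive1n n F) x 1.

End smooth.

Section function_classes.
Context {d} {T : measurableType d} {R : realType}.
Variable mu : {measure set T -> \bar R}.
Implicit Types (B C : set (T -> R)) (Gamma : (T -> R) -> (T -> R) -> T -> R).

(* Functions rather than classes; identities between functions are read
   mu-almost everywhere below. *)
Definition Lp (p : R) : set (T -> R) :=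
  [set f | measurable_fun setT f /\ finite_norm mu p%:E f].

Definition dense_in_Lp (p : R) B : Prop :=
  B `<=` Lp p /\
  forall f, Lp p f -> forall e : R, 0 < e ->
    exists2 g, B g & ('N[mu]_p%:E[EFin \o (f \- g)%R] < e%:E)%E.

Definition vector_space B : Prop :=
  B (cst 0) /\
  forall (a : R) f g, B f -> B g -> B (fun x => a * f x + g x).

Definition closed_under_products B : Prop :=
  forall f g, B f -> B g -> B (f \* g).

Definition compose_rV (k : nat) (Psi : 'rV[R]_k -> R) (f : 'I_k -> T -> R) :
    T -> R :=
  fun x => Psi (\row_i f i x).

Definition closed_under_smooth B : Prop :=
  forall (k : nat) (Psi : 'rV[R]_k -> R) (f : 'I_k -> T -> R),
    smooth_rV Psi -> Psi 0 = 0 -> (forall i, B (f i)) -> B (compose_rV Psi f).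

Definition chain_rule Gamma B : Prop :=
  forall (k : nat) (Psi : 'rV[R]_k -> R) (f : 'I_k -> T -> R) (g : T -> R),
    smooth_rV Psi -> Psi 0 = 0 -> (forall i, B (f i)) -> B g ->
    \forall x \ae mu, Gamma (compose_rV Psi f) g x =
      \sum_(i < k) compose_rV ('D_(delta_mx 0 i) Psi) f x * Gamma (f i) g x.

Definition linear_on (L : (T -> R) -> T -> R) B : Prop :=
  forall (a : R) f g, B f -> B g ->
    \forall x \ae mu, L (fun y => a * f y + g y) x = a * L f x + L g x.

End function_classes.

Section dirichlet_form.
Context {d} {T : measurableType d} {R : realType}.
Variable mu : {measure set T -> \bar R}.
Variables (A0 : set (T -> R)) (Gamma : (T -> R) -> (T -> R) -> T -> R).

Definition form0 (f g : T -> R) : R := \int[mu]_x Gamma f g x.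

(* f_ is a Cauchy sequence of A0 for the norm (|f|_2^2 + E(f,f))^(1/2), with
   limit f in L^2. *)
Definition form_approx (f_ : nat -> T -> R) (f : T -> R) : Prop :=
  [/\ forall n, A0 (f_ n),
      ('N[mu]_2%:E[EFin \o (f_ n \- f)%R])%E @[n --> \oo] --> 0%E &
      forall e : R, 0 < e ->
        \forall m & n \near \oo, form0 (f_ m \- f_ n) (f_ m \- f_ n) < e].

(* The completion of A0, realised inside L^2: the form is closable since
   f |-> E(f,g) is L^2-bounded for each g in A0. *)
Definition form_dom : set (T -> R) :=
  [set f | Lp mu 2 f /\ exists f_, form_approx f_ f].

(* form f g e: the extension by continuity of the form takes the value e at
   (f, g). *)
Definition form (f g : T -> R) (e : R) : Prop :=
  exists f_ g_, [/\ form_approx f_ f, form_approx g_ g &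
    form0 (f_ n) (g_ n) @[n --> \oo] --> e].

Definition gen_dom : set (T -> R) :=
  [set f | form_dom f /\
    exists2 C : R, 0 < C &
      forall g, form_dom g -> forall e, form f g e ->
        (`|e|%:E <= C%:E * 'N[mu]_2%:E[EFin \o g])%E].

(* The graph of the extension of L to gen_dom. *)
Definition gen (f h : T -> R) : Prop :=
  [/\ gen_dom f, Lp mu 2 h &
      forall g, form_dom g -> form f g (- \int[mu]_x (g x * h x))].

(* gen is densely defined and its graph is that of its L^2-adjoint. *)
Definition gen_self_adjoint : Prop :=
  dense_in_Lp mu 2 gen_dom /\
  forall f h, Lp mu 2 f -> Lp mu 2 h ->
    (gen f h <->
     forall f' h', gen f' h' ->
       \int[mu]_x (h' x * f x) = \int[mu]_x (f' x * h x)).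

End dirichlet_form.

Section markov_triple.
Context {d} {T : measurableType d} {R : realType}.
Variable mu : {measure set T -> \bar R}.
Variables (A0 A : set (T -> R)) (Gamma : (T -> R) -> (T -> R) -> T -> R).
Variable L : (T -> R) -> T -> R.

Record diffusion_triple : Prop := DiffusionTriple {
  A0_L1 : A0 `<=` Lp mu 1 ;
  A0_vector_space : vector_space A0 ;
  A0_dense : forall p : R, 1 <= p -> dense_in_Lp mu p A0 ;
  A0_mul : closed_under_products A0 ;
  A0_smooth : closed_under_smooth A0 ;
  Gamma_A0 : forall f g, A0 f -> A0 g -> A0 (Gamma f g) ;
  Gamma_sym : forall f g, A0 f -> A0 g -> Gamma f g = Gamma g f %[ae mu] ;
  Gamma_linear : forall g, A0 g -> linear_on mu (Gamma ^~ g) A0 ;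
  Gamma_ge0 : forall f, A0 f -> \forall x \ae mu, 0 <= Gamma f f x ;
  Gamma_chain : chain_rule mu Gamma A0 ;
  Gamma_bounded : forall f, A0 f -> exists2 C : R, 0 < C &
    forall g, A0 g ->
      (`|\int[mu]_x Gamma f g x|%R%:E <= C%:E * 'N[mu]_2%:E[EFin \o g])%E ;
  L_A0_linear : linear_on mu L A0 ;
  L_A0_L2 : forall f, A0 f -> Lp mu 2 (L f) ;
  L_A0_by_parts : forall f g, A0 f -> A0 g ->
    \int[mu]_x (g x * L f x) = - \int[mu]_x Gamma f g x ;
  L_self_adjoint : gen_self_adjoint mu A0 Gamma ;
  (* xi k is the (k+1)-st term of the sequence *)
  A0_cutoff : exists xi : nat -> T -> R,
    [/\ forall k, A0 (xi k),
        forall k x, xi k x <= xi k.+1 x,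
        forall k x, 0 <= xi k x <= 1,
        \forall x \ae mu, xi k x @[k --> \oo] --> (1 : R) &
        forall k, \forall x \ae mu, Gamma (xi k) (xi k) x <= k.+1%:R^-1]
}.

Record extended_algebra : Prop := ExtendedAlgebra {
  A_measurable : forall f, A f -> measurable_fun setT f ;
  A0_sub_A : A0 `<=` A ;
  A_vector_space : vector_space A ;
  A_mul : closed_under_products A ;
  A_cst : forall c : R, A (cst c) ;
  A_A0_mul : forall f h, A f -> A0 h -> A0 (h \* f) ;
  (* "positive" test functions are the nonnegative ones *)
  A_test_ge0 : forall f, A f ->
    (forall h, A0 h -> (\forall x \ae mu, 0 <= h x) ->
       0 <= \int[mu]_x (h x * f x)) ->
    \forall x \ae mu, 0 <= f x ;
  A_smooth : closed_under_smooth A ;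
  Gamma_A_chain : chain_rule mu Gamma A ;
  L_A : forall f, A f -> A (L f) ;
  L_A_linear : linear_on mu L A ;
  Gamma_A : forall f g, A f -> A g -> A (Gamma f g) ;
  Gamma_A_def : forall f g, A f -> A g ->
    \forall x \ae mu,
      Gamma f g x = 2^-1 * (L (f \* g) x - f x * L g x - g x * L f x) ;
  Gamma_A_ge0 : forall f, A f -> \forall x \ae mu, 0 <= Gamma f f x ;
  (* g * L f is in A0, hence integrable; the other two integrals have to exist. *)
  L_A_by_parts : forall f g, A f -> A0 g ->
    [/\ mu.-integrable setT (EFin \o Gamma f g),
        mu.-integrable setT (EFin \o (f \* L g)),
        \int[mu]_x Gamma f g x = - \int[mu]_x (g x * L f x) &
        \int[mu]_x Gamma f g x = - \int[mu]_x (f x * L g x)] ;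
  Gamma_eq0_cst : forall f, A f -> Gamma f f = cst 0 %[ae mu] ->
    exists c : R, f = cst c %[ae mu]
}.

Definition Gamma2 (f g : T -> R) : T -> R :=
  fun x => 2^-1 * (L (Gamma f g) x - Gamma f (L g) x - Gamma g (L f) x).

(* Gamma (w^(1/2)) for w >= 0, expanded by the chain rule; w^(1/2) itself need
   not belong to A. *)
Definition Gamma_sqrt (w : T -> R) : T -> R :=
  fun x => if w x == 0 then 0 else Gamma w w x / (4 * w x).

Definition weak_solution (F : R -> R) (u : T -> R) : Prop :=
  A u /\ forall phi, A0 phi ->
    \int[mu]_x Gamma u phi x = \int[mu]_x (F (u x) * phi x).

Definition stable (F : R -> R) (u : T -> R) : Prop :=
  forall phi, A0 phi ->
    0 <= \int[mu]_x Gamma phi phi x - \int[mu]_x (derive1 F (u x) * phi x ^+ 2).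

End markov_triple.

(* Main.v *)
Require Import Defs.
From mathcomp Require Import all_boot all_order all_algebra.
From mathcomp Require Import all_classical all_reals all_analysis.
From mathcomp Require Import ring lra measurable_realfun.
Set Implicit Arguments.
Unset Strict Implicit.
Unset Printing Implicit Defensive.
Import Order.TTheory GRing.Theory Num.Theory.
Import numFieldNormedType.Exports.
Local Open Scope classical_set_scope.
Local Open Scope ring_scope.

(** Write [w] for [Gamma u u].  Applying [Gamma u] to the equation [L u = - F u]
    and using the chain rule turns the definition of [Gamma2] into the
    Bochner-type identity
      [Gamma2 u = L w / 2 + F'(u) w] almost everywhere.
    The idea is then to test stability with [phi * w^(1/2)].  Expanding
    [Gamma (phi * w^(1/2))] by the Leibniz rule and integrating the cross term
    [Gamma w (phi^2) / 2] by parts, all the terms containing [L] or [F'(u)]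
    cancel against the integral of [Gamma2 u * phi^2], and what is left is the
    claimed inequality.

    The square root is not smooth, so [w^(1/2)] is replaced by [g(w)] with
    [g(t) = (t^2 + e^2)^(1/4)].  This function is smooth on the whole line,
    which matters because [w] is nonnegative only almost everywhere.  Moreover
    [|g(t)^2 - t| <= e] and [g'(t)^2 <= 1 / (4 t)] for [t > 0], while
    [g'(0) = 0]; the last two facts say that [Gamma (g(w))] is dominated by
    [Gamma (w^(1/2))] as defined by [Gamma_sqrt].  So this term needs no
    limit: it is compared pointwise, also when its integral is infinite.
    The remaining error is at most [e] times the integral of [|K|], where
      [K = Gamma phi - L (phi^2) / 2 - F'(u) phi^2]
    does not depend on [e] and is integrable; [L (phi^2)] is integrable because
    it is paired with the constant 1 in the integration by parts formula.  The
    theorem follows by letting [e] go to 0. *)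

(** * Smooth functions of one real variable *)

Section smooth_functions.
Context {R : realType}.
Implicit Types (f : R -> R) (e t a : R).

Lemma smooth_derive1 f : smooth f -> smooth (derive1 f).
Proof. by move=> sf n x; rewrite -derive1Sn; exact: (sf n.+1). Qed.

Lemma smoothBr f (c : R) : smooth f -> smooth (fun t => f t - c).
Proof.
move=> sf.
have E n : (fun t => f t - c)^`(n)%classic =
           (fun t => f^`(n)%classic t - (c *+ (n == 0))).
  elim: n => [|n IH]; first by rewrite !derive1n0 mulr1n.
  rewrite derive1nS IH mulr0n; apply/funext => x.
  rewrite derive1E deriveB; [|exact: sf|exact: derivable_cst].
  by rewrite derive_cst derive1nS derive1E.
by move=> n x; rewrite E; apply: derivableB; [exact: sf|exact: derivable_cst].
Qed.

(** The smooth calculus of the triple is stated for functions of [k] variables;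
    for [k = 1] these are the functions [first_coord f]. *)
Definition first_coord f : 'rV[R]_1 -> R := fun v => f (v 0 0).

(** The difference quotients agree before any limit is taken, so both the
    existence and the value of the directional derivative carry over. *)
Lemma derive_first_coord_quotient f (i : 'I_1) (v : 'rV[R]_1) :
  (fun h : R => h^-1 *: ((first_coord f \o shift v) (h *: delta_mx 0 i)
                         - first_coord f v)) =
  (fun h : R => h^-1 *: ((f \o shift (v 0 0)) (h *: 1) - f (v 0 0))).
Proof.
apply/funext => h; rewrite /first_coord /shift/= !mxE ord1 eqxx/=.
by rewrite /GRing.scale/=.
Qed.

Lemma derive_first_coord f (i : 'I_1) :
  'D_(delta_mx 0 i) (first_coord f) = first_coord (derive1 f).
Proof.
apply/funext => v; rewrite {2}/first_coord derive1E /derive.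
by rewrite derive_first_coord_quotient.
Qed.

Lemma derivable_first_coord f (i : 'I_1) (v : 'rV[R]_1) :
  derivable f (v 0 0) 1 -> derivable (first_coord f) v (delta_mx 0 i).
Proof. by rewrite /derivable derive_first_coord_quotient. Qed.

Lemma smooth_first_coord f : smooth f -> smooth_rV (first_coord f).
Proof.
move=> sf s.
have -> : iter_partial s (first_coord f) =
          first_coord (f^`(size s)%classic).
  elim: s => [//|i s IH] /=.
  by rewrite IH derive_first_coord -derive1nS.
split.
- move=> v; apply: continuous_comp; first exact: coord_continuous.
  by apply: differentiable_continuous; apply/derivable1_diffP; exact: sf.
- by move=> i v; apply: derivable_first_coord; exact: sf.
Qed.

Lemma smooth_poly (p : {poly R}) : smooth (horner p).
Proof.
have E n : (horner p)^`(n)%classic = horner (derivn n p).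
  elim: n => [//|n IH]; rewrite derive1nS IH derivnS; apply/funext => x.
  by rewrite derive1E (@derive_val _ _ _ _ _ _ _ (is_derive_poly _ _)).
move=> n x; rewrite E.
exact: (@ex_derive _ _ _ _ _ _ _ (is_derive_poly _ _)).
Qed.

(** The function [t |-> (t^2 + e^2)^a]. *)
Definition sqpow e a t : R := expR (a * ln (t ^+ 2 + e ^+ 2)).

Lemma sqpow_base_gt0 e t : 0 < e -> 0 < t ^+ 2 + e ^+ 2.
Proof. by move=> e0; rewrite ltr_wpDl ?sqr_ge0// exprn_gt0. Qed.

Lemma sqpow_gt0 e a t : 0 < sqpow e a t.
Proof. exact: expR_gt0. Qed.

Lemma sqpowD e a b t : sqpow e (a + b) t = sqpow e a t * sqpow e b t.
Proof. by rewrite /sqpow mulrDl expRD. Qed.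

Lemma sqpow1 e t : 0 < e -> sqpow e 1 t = t ^+ 2 + e ^+ 2.
Proof. by move=> e0; rewrite /sqpow mul1r lnK// posrE sqpow_base_gt0. Qed.

Lemma is_derive_sqpow e a t : 0 < e ->
  is_derive t 1 (sqpow e a) (2 * a * t * sqpow e (a - 1) t).
Proof.
move=> e0.
have q0 := sqpow_base_gt0 t e0.
have dq : is_derive t 1 (fun s : R => s ^+ 2 + e ^+ 2) (2 * t).
  apply: is_derive_eq; rewrite addr0 /GRing.scale/=; ring.
have dln : is_derive t 1 (@ln R \o (fun s : R => s ^+ 2 + e ^+ 2))
    ((t ^+ 2 + e ^+ 2)^-1 * (2 * t)).
  exact: (@is_derive1_comp _ _ (fun s : R => s ^+ 2 + e ^+ 2) _ _ _
    (is_derive1_ln q0) dq).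
have dm : is_derive t 1 (fun s : R => a * ln (s ^+ 2 + e ^+ 2))
    (a * ((t ^+ 2 + e ^+ 2)^-1 * (2 * t))).
  exact: (is_deriveZ a dln).
have := @is_derive1_comp _ _ (fun s : R => a * ln (s ^+ 2 + e ^+ 2)) _ _ _
  (is_derive_expR _) dm.
rewrite -[expR (_ * _)]/(sqpow e a t).
have -> : sqpow e a t = sqpow e (a - 1) t * (t ^+ 2 + e ^+ 2).
  by rewrite -(sqpow1 t e0) -sqpowD subrK.
move=> H; apply: (@is_derive_eq _ _ _ _ _ _ _ _ H).
by field; rewrite gt_eqF.
Qed.

(** The n-th derivative is [p * sqpow e (a - n)] for some polynomial [p], and
    the functions of this form are differentiable. *)
Lemma smooth_sqpow e a : 0 < e -> smooth (sqpow e a).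
Proof.
move=> e0.
have D (p : {poly R}) b t : is_derive t 1 (fun s => p.[s] * sqpow e b s)
   ((p^`() * ('X^2 + (e ^+ 2)%:P) + (2 * b) *: ('X * p)).[t]
    * sqpow e (b - 1) t).
  have := is_deriveM (is_derive_poly p t) (is_derive_sqpow b t e0).
  move=> H; apply: (@is_derive_eq _ _ _ _ _ _ _ _ H).
  rewrite !hornerE /GRing.scale/=.
  have -> : sqpow e b t = sqpow e (b - 1) t * (t ^+ 2 + e ^+ 2).
    by rewrite -(sqpow1 t e0) -sqpowD subrK.
  ring.
have E n : exists p : {poly R},
    (sqpow e a)^`(n)%classic = (fun t => p.[t] * sqpow e (a - n%:R) t).
  elim: n => [|n [p IH]].
    exists 1; rewrite derive1n0; apply/funext => t.
    by rewrite hornerC mul1r subr0.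
  exists (p^`() * ('X^2 + (e ^+ 2)%:P) + (2 * (a - n%:R)) *: ('X * p)).
  rewrite derive1nS IH; apply/funext => t.
  rewrite derive1E (@derive_val _ _ _ _ _ _ _ (D _ _ _)).
  by have -> : a - n.+1%:R = a - n%:R - 1 by rewrite -(natr1 n) opprD addrA.
move=> n t; have [p ->] := E n.
exact: (@ex_derive _ _ _ _ _ _ _ (D _ _ _)).
Qed.

End smooth_functions.

(** * The regularised square root *)

Section quarter_power.
Context {R : realType} (e : R) (e_gt0 : 0 < e).
Implicit Type t : R.

Local Notation g := (sqpow e 4^-1).
Local Notation G := (sqpow e 2^-1).

Lemma quarter_sq t : g t ^+ 2 = G t.
Proof. by rewrite expr2 -sqpowD; congr (sqpow e _ t); field. Qed.

Lemma half_sq t : G t ^+ 2 = t ^+ 2 + e ^+ 2.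
Proof. by rewrite expr2 -sqpowD -sqpow1//; congr (sqpow e _ t); field. Qed.

Lemma half_ge t : 0 <= t -> t <= G t.
Proof.
move=> t0; rewrite -(ler_pXn2r (n := 2))// ?nnegrE ?(ltW (sqpow_gt0 _ _ _))//.
by rewrite half_sq lerDl sqr_ge0.
Qed.

Lemma half_dist t : 0 <= t -> `|G t - t| <= e.
Proof.
move=> t0; rewrite ger0_norm ?subr_ge0 ?half_ge// lerBlDr.
rewrite -(ler_pXn2r (n := 2))// ?nnegrE;
  [|exact: ltW (sqpow_gt0 _ _ _)|by rewrite addr_ge0// ltW].
rewrite half_sq.
have : 0 <= e * t by rewrite mulr_ge0// ltW.
nra.
Qed.

Lemma quarter_derive t : derive1 g t = 2^-1 * t * sqpow e (4^-1 - 1) t.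
Proof.
have H := is_derive_sqpow 4^-1 t e_gt0.
rewrite derive1E (@derive_val _ _ _ _ _ _ _ H).
by congr (_ * _); field.
Qed.

(** With [S = (t^2 + e^2)^(-3/4)], so that [g' = t S / 2], the claim is
    [t^3 S^2 <= 1]; it follows from [t <= G t] and [S^2 (G t)^3 = 1]. *)
Lemma quarter_derive_le t : 0 < t -> derive1 g t ^+ 2 <= (4 * t)^-1.
Proof.
move=> t0; rewrite quarter_derive; set S := sqpow e _ t.
have SG : S ^+ 2 * G t ^+ 3 = 1.
  rewrite !expr2 !exprS expr0 mulr1 -!sqpowD.
  rewrite (_ : _ + _ = 0); first by rewrite /sqpow mul0r expR0.
  by field.
have tG : t ^+ 3 <= G t ^+ 3.
  rewrite ler_pXn2r// ?nnegrE ?(ltW (sqpow_gt0 _ _ _)) ?(ltW t0)//.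
  by rewrite half_ge// ltW.
have H : S ^+ 2 * t ^+ 3 <= 1 by rewrite -SG ler_wpM2l// sqr_ge0.
rewrite -[leRHS]mul1r ler_pdivlMr ?mulr_gt0//.
by apply: le_trans H; rewrite le_eqVlt; apply/orP; left; apply/eqP; field.
Qed.

End quarter_power.

(** * Calculus of the generator and the carré du champ on the algebra *)

Section carre_du_champ.
Context {d} {T : measurableType d} {R : realType}.
Context (mu : {measure set T -> \bar R}).
Context (A0 A : set (T -> R)) (Gamma : (T -> R) -> (T -> R) -> T -> R).
Context (L : (T -> R) -> T -> R).
Context (DT : diffusion_triple mu A0 Gamma L).
Context (EA : extended_algebra mu A0 A Gamma L).
Implicit Types (f g h : T -> R) (a b c : R) (psi : R -> R).

Lemma ae_app {P Q : T -> Prop} : (\forall x \ae mu, P x) ->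
  (\forall x \ae mu, P x -> Q x) -> \forall x \ae mu, Q x.
Proof. by move=> mP; apply: filterS2 mP => x Px /(_ Px). Qed.

Lemma A0_integrable f : A0 f -> mu.-integrable setT (EFin \o f).
Proof.
move=> /(A0_L1 DT)[mf]; rewrite /finite_norm Lnorm1 => foo.
by apply/integrableP; split => //; exact/measurable_EFinP.
Qed.

Lemma A_scale_add a f g : A f -> A g -> A (fun x => a * f x + g x).
Proof. exact: (A_vector_space EA).2. Qed.

Lemma A_ext f g : f =1 g -> A f -> A g.
Proof. by move=> /funext ->. Qed.

Lemma A_sub f g : A f -> A g -> A (fun x => f x - g x).
Proof.
move=> Af Ag; apply: (A_ext _ (A_scale_add (-1) Ag Af)) => x; ring.
Qed.

Lemma A_opp f : A f -> A (fun x => - f x).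
Proof.
move=> Af; apply: (A_ext _ (A_sub (A_cst EA 0) Af)) => x /=; ring.
Qed.

Lemma A_add f g : A f -> A g -> A (fun x => f x + g x).
Proof.
move=> Af Ag; apply: (A_ext _ (A_scale_add 1 Af Ag)) => x; ring.
Qed.

Lemma A_scale a f : A f -> A (fun x => a * f x).
Proof.
move=> Af; apply: (A_ext _ (A_scale_add a Af (A_cst EA 0))) => x /=; ring.
Qed.

Lemma A_test_eq0 f : A f ->
  (forall h, A0 h -> \int[mu]_x (h x * f x) = 0) ->
  \forall x \ae mu, f x = 0.
Proof.
move=> Af f0.
have fge : \forall x \ae mu, 0 <= f x.
  by apply: (A_test_ge0 EA Af) => h A0h _; rewrite f0.
have fle : \forall x \ae mu, 0 <= - f x.
  apply: (A_test_ge0 EA (A_opp Af)) => h A0h _.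
  under eq_Rintegral do rewrite mulrN -mulN1r.
  rewrite RintegralZl// ?f0 ?mulr0//.
  exact: (A0_integrable (A_A0_mul EA Af A0h)).
by apply: filterS2 fge fle => x; lra.
Qed.

(** [L] acts on functions rather than on classes.  It is compatible with almost
    everywhere equality because of integration by parts: if [f - g] vanishes
    almost everywhere, then the integral of [h * L (f - g)], which is that of
    [(f - g) * L h], is 0 for every test function [h]. *)
Lemma L_ae_eq f g : A f -> A g -> (\forall x \ae mu, f x = g x) ->
  \forall x \ae mu, L f x = L g x.
Proof.
move=> Af Ag fg.
have Afg : A (fun x => -1 * g x + f x) by exact: A_scale_add.
have Lfg0 : \forall x \ae mu, L (fun x => -1 * g x + f x) x = 0.
  apply: A_test_eq0 => [|h A0h]; first exact: (L_A EA).
  have [_ iL e1 e2] := L_A_by_parts EA Afg A0h.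
  apply/eqP; rewrite -eqr_opp oppr0 -e1 e2 oppr_eq0; apply/eqP.
  rewrite /Rintegral (ae_eq_integral (cst 0%E))// ?integral0//.
    by case/integrableP : iL.
  by apply: filterS fg => x fgx _; rewrite /= fgx mulN1r addNr mul0r.
apply: filterS2 Lfg0 (L_A_linear EA (-1) Ag Af) => x -> ; lra.
Qed.

Lemma Gamma_A_sym f g : A f -> A g ->
  \forall x \ae mu, Gamma f g x = Gamma g f x.
Proof.
move=> Af Ag; apply: filterS2 (Gamma_A_def EA Af Ag) (Gamma_A_def EA Ag Af).
move=> x -> ->.
have -> : f \* g = g \* f by apply/funext => y /=; rewrite mulrC.
ring.
Qed.

Lemma Gamma_ae_eq f g h : A f -> A g -> A h -> (\forall x \ae mu, g x = h x) ->
  \forall x \ae mu, Gamma f g x = Gamma f h x.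
Proof.
move=> Af Ag Ah gh.
have Lfgh : \forall x \ae mu, L (f \* g) x = L (f \* h) x.
  apply: L_ae_eq; [exact: (A_mul EA)|exact: (A_mul EA)|].
  by apply: filterS gh => x /= ->.
refine (ae_app (Gamma_A_def EA Af Ag) _).
refine (ae_app (Gamma_A_def EA Af Ah) _).
refine (ae_app Lfgh _); refine (ae_app (L_ae_eq Ag Ah gh) _).
by refine (ae_app gh _); apply: nearW => x -> -> -> -> ->.
Qed.

Lemma Gamma_A_linear a f g h : A f -> A g -> A h ->
  \forall x \ae mu, Gamma (fun y => a * f y + g y) h x =
    a * Gamma f h x + Gamma g h x.
Proof.
move=> Af Ag Ah.
have E : (fun y => a * f y + g y) \* h
         = (fun y => a * (f \* h) y + (g \* h) y).
  by apply/funext => y /=; ring.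
refine (ae_app (Gamma_A_def EA Af Ah) _).
refine (ae_app (Gamma_A_def EA Ag Ah) _).
refine (ae_app (L_A_linear EA a Af Ag) _).
refine (ae_app (L_A_linear EA a (A_mul EA Af Ah) (A_mul EA Ag Ah)) _).
refine (ae_app (Gamma_A_def EA (A_scale_add a Af Ag) Ah) _).
by apply: nearW => x; rewrite E => -> -> -> -> ->; ring.
Qed.

Lemma A_compose psi f : smooth psi -> A f -> A (psi \o f).
Proof.
move=> spsi Af.
have smooth0 := smooth_first_coord (smoothBr (c := psi 0) spsi).
have A0psi := A_smooth EA smooth0 _ (fun=> Af).
apply: (A_ext _ (A_add (A0psi _) (A_cst EA (psi 0)))) => [x|].
  by rewrite /compose_rV /first_coord/= mxE subrK.
by rewrite /first_coord mxE subrr.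
Qed.

Lemma Gamma_sqr f h : A f -> A h ->
  \forall x \ae mu, Gamma (f \* f) h x = 2 * f x * Gamma f h x.
Proof.
move=> Af Ah.
have spoly := smooth_poly (p := 'X ^+ 2 : {poly R}).
have P0 : first_coord (horner ('X^2 : {poly R})) 0 = 0.
  by rewrite /first_coord !hornerE mxE expr2 mulr0.
have := Gamma_A_chain EA (smooth_first_coord spoly) P0 (fun=> Af) Ah.
have -> : compose_rV (first_coord (horner ('X^2))) (fun=> f) = f \* f.
  by apply/funext => x; rewrite /compose_rV /first_coord !hornerE mxE expr2.
apply: filterS => x ->.
rewrite big_ord1 derive_first_coord /compose_rV /first_coord mxE derive1E.
rewrite (@derive_val _ _ _ _ _ _ _ (is_derive_poly _ _)) derivXn/= !hornerE.
by rewrite mulr_natl.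
Qed.

(** For [c = 1] this is the chain rule for the square applied to [1 * 1 = 1],
    and the general case follows by linearity. *)
Lemma Gamma_cst c h : A h -> \forall x \ae mu, Gamma (cst c) h x = 0.
Proof.
move=> Ah.
have A1 := A_cst EA 1.
have H1 : \forall x \ae mu, Gamma (cst 1) h x = 0.
  have := Gamma_sqr A1 Ah.
  have -> : (cst 1 : T -> R) \* cst 1 = cst 1.
    by apply/funext => x /=; rewrite mulr1.
  by apply: filterS => x /=; lra.
have := Gamma_A_linear (c - 1) A1 A1 Ah.
have -> : (fun y => (c - 1) * (cst 1 : T -> R) y + (cst 1 : T -> R) y) = cst c.
  by apply/funext => x /=; ring.
by apply: filterS2 H1 => x -> ->; ring.
Qed.

(** The chain rule of the triple asks for [psi 0 = 0]; subtracting the constant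
    [psi 0] changes neither side. *)
Lemma Gamma_compose psi f g : smooth psi -> A f -> A g ->
  \forall x \ae mu, Gamma (psi \o f) g x = derive1 psi (f x) * Gamma f g x.
Proof.
move=> spsi Af Ag.
have smooth0 := smooth_first_coord (smoothBr (c := psi 0) spsi).
set Psi := first_coord _ in smooth0.
have Psi0 : Psi 0 = 0 by rewrite /Psi /first_coord mxE subrr.
have AP := A_smooth EA smooth0 Psi0 (fun=> Af).
have := Gamma_A_linear 1 AP (A_cst EA (psi 0)) Ag.
have -> : (fun y => 1 * compose_rV Psi (fun=> f) y + (cst (psi 0) : T -> R) y)
           = psi \o f.
  by apply/funext => x; rewrite /compose_rV /Psi /first_coord/= mxE mul1r subrK.
apply: filter_app; refine (ae_app (Gamma_cst (psi 0) Ag) _).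
refine (ae_app (Gamma_A_chain EA smooth0 Psi0 (fun=> Af) Ag) _).
apply: nearW => x -> -> ->.
rewrite mul1r addr0 big_ord1 derive_first_coord /compose_rV /first_coord mxE.
rewrite !derive1E deriveB ?derive_cst ?subr0//; exact: (spsi 0).
Qed.

(** Polarisation of [Gamma_sqr]: expand the square of [f + g]. *)
Lemma Gamma_mul f g h : A f -> A g -> A h ->
  \forall x \ae mu, Gamma (f \* g) h x = f x * Gamma g h x + g x * Gamma f h x.
Proof.
move=> Af Ag Ah.
pose s x := 1 * f x + g x.
have As : A s by exact: A_scale_add.
pose q x := 1 * (f \* f) x + (g \* g) x.
have Aff : A (f \* f) by exact: (A_mul EA).
have Agg : A (g \* g) by exact: (A_mul EA).
have Aq : A q by exact: A_scale_add.
have Afg : A (f \* g) by exact: (A_mul EA).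
have E : (fun x => 2 * (f \* g) x + q x) = s \* s.
  by apply/funext => x; rewrite /s /q /=; ring.
have := Gamma_A_linear 2 Afg Aq Ah; rewrite E.
apply: filter_app; refine (ae_app (Gamma_A_linear 1 Aff Agg Ah) _).
refine (ae_app (Gamma_A_linear 1 Af Ag Ah) _).
refine (ae_app (Gamma_sqr Af Ah) _); refine (ae_app (Gamma_sqr Ag Ah) _).
refine (ae_app (Gamma_sqr As Ah) _).
apply: nearW => x; rewrite -/s -/q => -> -> -> -> ->; rewrite /s; lra.
Qed.

(** The cross term [2 f g Gamma f g] of the expansion is written as
    [Gamma (g^2) (f^2) / 2], the form in which it can be integrated by parts. *)
Lemma Gamma_mul_mul f g : A f -> A g ->
  \forall x \ae mu, Gamma (f \* g) (f \* g) x =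
    (g \* g) x * Gamma f f x + 2^-1 * Gamma (g \* g) (f \* f) x
    + (f \* f) x * Gamma g g x.
Proof.
move=> Af Ag.
have Aff : A (f \* f) by exact: (A_mul EA).
have Agg : A (g \* g) by exact: (A_mul EA).
have Afg : A (f \* g) by exact: (A_mul EA).
refine (ae_app (Gamma_mul Af Ag Afg) _).
refine (ae_app (Gamma_A_sym Ag Afg) _).
refine (ae_app (Gamma_A_sym Af Afg) _).
refine (ae_app (Gamma_mul Af Ag Ag) _).
refine (ae_app (Gamma_mul Af Ag Af) _).
refine (ae_app (Gamma_A_sym Ag Af) _).
refine (ae_app (Gamma_sqr Ag Aff) _).
refine (ae_app (Gamma_A_sym Ag Aff) _).
refine (ae_app (Gamma_sqr Af Ag) _).
apply: nearW => x e1 e2 e3 e4 e5 e6 e7 e8 e9.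
by rewrite e9 e8 e7 e6 e5 e3 e2 e1 e4 /=; field.
Qed.

End carre_du_champ.

(** * Comparison of integrals *)

Section integral_comparison.
Context {d} {T : measurableType d} {R : realType}.
Context (mu : {measure set T -> \bar R}).
Implicit Types (f g : T -> R).

(** Positive and negative parts are compared separately, so that [f] may have
    integral [-oo]; this happens below when [Gamma (w^(1/2)) * phi^2] is not
    integrable. *)
Lemma ae_le_integral (f g : T -> \bar R) :
  measurable_fun setT f -> measurable_fun setT g ->
  (\forall x \ae mu, (f x <= g x)%E) ->
  (\int[mu]_x f x <= \int[mu]_x g x)%E.
Proof.
move=> mf mg fg; rewrite integralE [leRHS]integralE leeB//.
- apply: ae_ge0_le_integral => //; [exact: measurable_funepos..|].
  by apply: filterS fg => x fgx _; rewrite !funeposE le_max2.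
- apply: ae_ge0_le_integral => //; [exact: measurable_funeneg..|].
  by apply: filterS fg => x fgx _; rewrite !funenegE le_max2// leeN2.
Qed.

Lemma EFin_Rintegral f : mu.-integrable setT (EFin \o f) ->
  (\int[mu]_x (f x)%:E)%E = (\int[mu]_x f x)%:E.
Proof. by move=> fi; rewrite /Rintegral fineK//; exact: integrable_fin_num. Qed.

Lemma ae_le_Rintegral f g :
  mu.-integrable setT (EFin \o f) -> mu.-integrable setT (EFin \o g) ->
  (\forall x \ae mu, f x <= g x) -> \int[mu]_x f x <= \int[mu]_x g x.
Proof.
move=> fi gi fg; rewrite -lee_fin -!EFin_Rintegral//.
apply: ae_le_integral; [by case/integrableP: fi|by case/integrableP: gi|].
by apply: filterS fg => x; rewrite lee_fin.
Qed.

Lemma ae_eq_Rintegral f g :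
  mu.-integrable setT (EFin \o f) -> mu.-integrable setT (EFin \o g) ->
  (\forall x \ae mu, f x = g x) -> \int[mu]_x f x = \int[mu]_x g x.
Proof.
move=> fi gi fg; apply/eqP; rewrite eq_le; apply/andP.
by split; apply: ae_le_Rintegral => //; apply: filterS fg => x ->.
Qed.

Lemma integrable_scale_add (a : R) f g :
  mu.-integrable setT (EFin \o f) -> mu.-integrable setT (EFin \o g) ->
  mu.-integrable setT (EFin \o (fun x => a * f x + g x)).
Proof.
move=> fi gi.
by apply: eq_integrable (integrableD _ (integrableZl _ a fi) gi).
Qed.

Lemma Rintegral_scale_add (a : R) f g :
  mu.-integrable setT (EFin \o f) -> mu.-integrable setT (EFin \o g) ->
  \int[mu]_x (a * f x + g x) = a * \int[mu]_x f x + \int[mu]_x g x.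
Proof.
move=> fi gi; rewrite RintegralD//; first by rewrite RintegralZl.
by apply: eq_integrable (integrableZl _ a fi).
Qed.

Lemma integrable_norm f : mu.-integrable setT (EFin \o f) ->
  mu.-integrable setT (EFin \o (fun x => `|f x|)).
Proof. by move=> /integrable_abse; apply: eq_integrable. Qed.

Lemma measurable_Gamma_sqrt (Gamma : (T -> R) -> (T -> R) -> T -> R) f :
  measurable_fun setT f -> measurable_fun setT (Gamma f f) ->
  measurable_fun setT (Gamma_sqrt Gamma f).
Proof.
move=> mf mG.
(* [expR (- ln (y ^+ 2))] is [y ^- 2] for [y] nonzero, and the factor [y]
   absorbs the value at 0. *)
have -> : Gamma_sqrt Gamma f =
    (fun x => Gamma f f x * (4^-1 * (f x * expR (- ln (f x ^+ 2))))).
  apply/funext => x; rewrite /Gamma_sqrt; case: eqVneq => [->|fx0].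
    by rewrite mul0r !mulr0.
  rewrite expRN lnK; last by rewrite posrE exprn_even_gt0.
  by field.
apply: measurable_funM => //; apply: measurable_funM => //.
apply: measurable_funM => //; apply: measurableT_comp => //.
apply: measurableT_comp => //; apply: measurableT_comp => //.
exact: measurable_funX.
Qed.

End integral_comparison.

(** * Stable solutions *)

Section stable_solutions.
Context {d} {T : measurableType d} {R : realType}.
Context (mu : {measure set T -> \bar R}).
Context (A0 A : set (T -> R)) (Gamma : (T -> R) -> (T -> R) -> T -> R).
Context (L : (T -> R) -> T -> R).
Context (DT : diffusion_triple mu A0 Gamma L).
Context (EA : extended_algebra mu A0 A Gamma L).
Context (F : R -> R) (u : T -> R).
Context (sF : smooth F) (sol : weak_solution mu A0 A Gamma F u).
Implicit Types (f g h phi : T -> R).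

Local Notation w := (Gamma u u).

Lemma A_sol : A u. Proof. exact: sol.1. Qed.

Lemma A_Gamma_sol : A w. Proof. by apply: (Gamma_A EA); exact: A_sol. Qed.

#[local] Hint Resolve A_sol A_Gamma_sol : core.

Lemma solution_ae : \forall x \ae mu, F (u x) + L u x = 0.
Proof.
have AFu : A (F \o u) by exact: (A_compose EA sF A_sol).
have AFL : A (fun x => 1 * (F \o u) x + L u x).
  by apply: (A_scale_add EA); last exact: (L_A EA A_sol).
have H0 h : A0 h -> \int[mu]_x (h x * (1 * (F \o u) x + L u x)) = 0.
  move=> A0h.
  have i1 := A0_integrable DT (A_A0_mul EA AFu A0h).
  have i2 := A0_integrable DT (A_A0_mul EA (L_A EA A_sol) A0h).
  transitivity (\int[mu]_x (1 * (h \* (F \o u)) x + (h \* L u) x)).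
    by apply: eq_Rintegral => x _ /=; ring.
  rewrite Rintegral_scale_add//= mul1r.
  have [_ _ e1 _] := L_A_by_parts EA A_sol A0h.
  have := sol.2 h A0h; rewrite e1 => e2.
  apply/eqP; rewrite addr_eq0 e2; apply/eqP/eq_Rintegral => x _ /=.
  by rewrite mulrC.
by apply: filterS (A_test_eq0 DT EA AFL H0) => x /=; rewrite mul1r.
Qed.

(** [Gamma u (L u) = - Gamma u (F u) = - F'(u) Gamma u u] by the equation and
    the chain rule. *)
Lemma Gamma2_solution :
  \forall x \ae mu, Gamma2 Gamma L u u x = 2^-1 * L w x + derive1 F (u x) * w x.
Proof.
have AFu : A (F \o u) by exact: (A_compose EA sF A_sol).
have A00 := A_cst EA 0.
have AmF : A (fun x => -1 * (F \o u) x + (cst 0 : T -> R) x).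
  exact: (A_scale_add EA).
have ALu : A (L u) by exact: (L_A EA).
have Lu : \forall x \ae mu, L u x = -1 * (F \o u) x + (cst 0 : T -> R) x.
  by apply: filterS solution_ae => x /=; lra.
refine (ae_app (Gamma_ae_eq DT EA A_sol ALu AmF Lu) _).
refine (ae_app (Gamma_A_sym EA A_sol AmF) _).
refine (ae_app (Gamma_A_linear EA (-1) AFu A00 A_sol) _).
refine (ae_app (Gamma_cst EA 0 A_sol) _).
refine (ae_app (Gamma_compose EA sF A_sol A_sol) _).
apply: nearW => x e1 e2 e3 e4 e5; rewrite /Gamma2 e5 e4 e3 e2 e1; by field.
Qed.

(** Stability tested with [phi * g], after expanding [Gamma (phi * g)] and
    integrating the cross term by parts so that [L] falls on [phi^2]. *)
Lemma stable_test g phi : stable mu A0 Gamma F u -> A g -> A0 phi ->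
  \int[mu]_x (derive1 F (u x) * (phi \* phi) x * (g \* g) x)
  <= \int[mu]_x ((g \* g) x * Gamma phi phi x)
     - 2^-1 * \int[mu]_x ((g \* g) x * L (phi \* phi) x)
     + \int[mu]_x ((phi \* phi) x * Gamma g g x).
Proof.
move=> st Ag A0phi.
have Aphi := A0_sub_A EA A0phi.
have A0phi2 := A0_mul DT A0phi A0phi.
have Agg : A (g \* g) by exact: (A_mul EA).
have A0t : A0 (phi \* g) by exact: (A_A0_mul EA).
have i1 : mu.-integrable setT (EFin \o (fun x => (g \* g) x * Gamma phi phi x)).
  have A0q := A_A0_mul EA Agg (Gamma_A0 DT A0phi A0phi).
  apply: eq_integrable (A0_integrable DT A0q) => //.
  by move=> x _ /=; rewrite mulrC.
have i3 := A0_integrable DT (A_A0_mul EA (Gamma_A EA Ag Ag) A0phi2).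
have [i2 _ _ e2] := L_A_by_parts EA Agg A0phi2.
have i23 := integrable_scale_add 2^-1 i2 i3.
have i123 := integrable_scale_add 1 i1 i23.
have := st _ A0t; rewrite subr_ge0.
have -> : \int[mu]_x Gamma (phi \* g) (phi \* g) x =
    \int[mu]_x (1 * ((g \* g) x * Gamma phi phi x) +
       (2^-1 * Gamma (g \* g) (phi \* phi) x + ((phi \* phi) \* Gamma g g) x)).
  apply: ae_eq_Rintegral => //.
    exact: (A0_integrable DT (Gamma_A0 DT A0t A0t)).
  by apply: filterS (Gamma_mul_mul EA Aphi Ag) => x ->; rewrite mul1r addrA.
rewrite Rintegral_scale_add// Rintegral_scale_add// e2 mul1r mulrN addrA.
apply: le_trans; rewrite le_eqVlt; apply/orP; left; apply/eqP.
by apply: eq_Rintegral => x _ /=; ring.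
Qed.

(** [Gamma (g(w)) = g'(w)^2 Gamma w], so the pointwise bounds on [g'] apply. *)
Lemma Gamma_quarter_le e : 0 < e ->
  \forall x \ae mu, Gamma (sqpow e 4^-1 \o w) (sqpow e 4^-1 \o w) x
                    <= Gamma_sqrt Gamma w x.
Proof.
move=> e0; set g := sqpow e 4^-1.
have sg : smooth g by exact: smooth_sqpow.
have Ag : A (g \o w) by exact: (A_compose EA).
refine (ae_app (Gamma_compose EA sg A_Gamma_sol Ag) _).
refine (ae_app (Gamma_A_sym EA A_Gamma_sol Ag) _).
refine (ae_app (Gamma_compose EA sg A_Gamma_sol A_Gamma_sol) _).
refine (ae_app (Gamma_A_ge0 EA A_Gamma_sol) _).
refine (ae_app (Gamma_A_ge0 EA A_sol) _).
apply: nearW => x w0 Gw e1 e2 e3; rewrite e3 e2 e1 mulrA -expr2 /Gamma_sqrt.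
case: eqVneq => [->|wn0].
  by rewrite quarter_derive// mulr0 mul0r expr2 mulr0 mul0r.
rewrite [leRHS]mulrC ler_wpM2r//; apply: quarter_derive_le => //.
by rewrite lt_def wn0.
Qed.

Lemma A_Gamma2 : A (Gamma2 Gamma L u u).
Proof.
have AGL : A (Gamma u (L u)) by apply: (Gamma_A EA) => //; exact: (L_A EA).
have ALw : A (L w) by exact: (L_A EA).
by apply: (A_scale EA); do 2 apply: (A_sub EA) => //.
Qed.

(** The integral multiplied by [e] is that of the norm of the function [K]
    described at the top: [K] is what [g(w)^2] is multiplied by when
    [stable_test] is gathered, and [|g(w)^2 - w| <= e]. *)
Lemma stable_approx e phi : stable mu A0 Gamma F u -> A0 phi -> 0 < e ->
  (\int[mu]_x ((Gamma2 Gamma L u u x - Gamma_sqrt Gamma w x) * phi x ^+ 2)%:E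
   <= (e * \int[mu]_x `|- 2^-1 * L (phi \* phi) x
                        + (-1 * (derive1 F (u x) * (phi \* phi) x)
                           + Gamma phi phi x)|
       + \int[mu]_x (w x * Gamma phi phi x))%:E)%E.
Proof.
move=> st A0phi e0.
pose g := sqpow e 4^-1 \o w.
pose G := g \* g.
pose s := Gamma g g.
pose p := phi \* phi.
pose F' := derive1 F \o u.
pose q := Gamma phi phi.
have Ag : A g by apply: (A_compose EA) => //; exact: smooth_sqpow.
have AG : A G by exact: (A_mul EA).
have As : A s by exact: (Gamma_A EA).
have A0p : A0 p by exact: (A0_mul DT).
have A0q : A0 q by exact: (Gamma_A0 DT).
have AF' : A F' by apply: (A_compose EA) => //; exact: smooth_derive1.
have A0F'p : A0 (fun x => F' x * p x).
  by apply: (A_ext _ (A_A0_mul EA AF' A0p)) => x /=; rewrite mulrC.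
have i1 : mu.-integrable setT (EFin \o (fun x => G x * q x)).
  apply: eq_integrable (A0_integrable DT (A_A0_mul EA AG A0q)) => // x _ /=.
  by rewrite mulrC.
have [_ i2 _ _] := L_A_by_parts EA AG A0p.
have i3 := A0_integrable DT (A_A0_mul EA As A0p).
have i4 := A0_integrable DT (A_A0_mul EA AG A0F'p).
have j1 : mu.-integrable setT (EFin \o (fun x => w x * q x)).
  have A0wq := A_A0_mul EA A_Gamma_sol A0q.
  apply: eq_integrable (A0_integrable DT A0wq) => // x _ /=.
  by rewrite mulrC.
have [_ j2 e1 e2] := L_A_by_parts EA A_Gamma_sol A0p.
have j3 := A0_integrable DT (A_A0_mul EA (L_A EA A_Gamma_sol) A0p).
have j4 := A0_integrable DT (A_A0_mul EA A_Gamma_sol A0F'p).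
have k2 : mu.-integrable setT (EFin \o L p).
  have [_ + _ _] := L_A_by_parts EA (A_cst EA 1) A0p.
  by apply: eq_integrable => // x _ /=; rewrite mul1r.
pose K x := - 2^-1 * L p x + (-1 * (F' x * p x) + q x).
have iK : mu.-integrable setT (EFin \o K).
  apply: integrable_scale_add => //.
  apply: (@integrable_scale_add _ _ _ mu (-1) (fun x => F' x * p x));
    exact: (A0_integrable DT).
(* [D] dominates the left-hand integrand: [Gamma2 u] is replaced by its value
   for a solution, and the square root by its regularisation. *)
pose D x := 2^-1 * (p \* L w) x
  + (-1 * (p \* s) x + ((fun y => F' y * p y) \* w) x).
have iD' := integrable_scale_add (-1) i3 j4.
have iD : mu.-integrable setT (EFin \o D) := integrable_scale_add 2^-1 j3 iD'.
have fD : (\int[mu]_x ((Gamma2 Gamma L u u x - Gamma_sqrt Gamma w x)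
                       * phi x ^+ 2)%:E
           <= (\int[mu]_x D x)%:E)%E.
  rewrite -EFin_Rintegral//; apply: ae_le_integral.
  - apply/measurable_EFinP; apply: measurable_funM.
      apply: measurable_funB; first exact: (A_measurable EA A_Gamma2).
      apply: measurable_Gamma_sqrt; first exact: (A_measurable EA A_Gamma_sol).
      by apply: (A_measurable EA); exact: (Gamma_A EA).
    by apply: measurable_funX; apply: (A_measurable EA); exact: (A0_sub_A EA).
  - by case/integrableP: iD.
  refine (ae_app Gamma2_solution _); refine (ae_app (Gamma_quarter_le e0) _).
  apply: nearW => x sle ->; rewrite lee_fin /D/= -/g -/s in sle *.
  have : 0 <= phi x ^+ 2 by rewrite sqr_ge0.
  rewrite expr2 => p0.
  have : s x * (phi x * phi x) <= Gamma_sqrt Gamma w x * (phi x * phi x).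
    by rewrite ler_wpM2r.
  by rewrite /F' /p /=; lra.
apply: le_trans fD _; rewrite lee_fin.
(* [M] is [w * Gamma phi + (G - w) * K], written as a sum of functions that are
   integrable one by one. *)
pose M x := - 2^-1 * (G \* L p) x + (2^-1 * (w \* L p) x + (1 * (G x * q x)
   + (-1 * ((fun y => F' y * p y) \* G) x + ((fun y => F' y * p y) \* w) x))).
have iM1 := integrable_scale_add (-1) i4 j4.
have iM2 := integrable_scale_add 1 i1 iM1.
have iM3 := integrable_scale_add 2^-1 j2 iM2.
have iM : mu.-integrable setT (EFin \o M) :=
  integrable_scale_add (- 2^-1) i2 iM3.
have DM : \int[mu]_x D x <= \int[mu]_x M x.
  rewrite /D /M !Rintegral_scale_add//.
  have := stable_test st Ag A0phi; rewrite -/G -/p -/q -/s.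
  move: e1 e2 => -> /eqP; rewrite eqr_opp => /eqP ->.
  lra.
apply: le_trans DM _.
rewrite -Rintegral_scale_add//; last exact: integrable_norm iK.
apply: ae_le_Rintegral => //.
  by apply: integrable_scale_add => //; exact: (integrable_norm iK).
refine (ae_app (Gamma_A_ge0 EA A_sol) _); apply: nearW => x w0.
have GK : (G x - w x) * K x <= e * `|K x|.
  apply: le_trans (ler_norm _) _; rewrite normrM ler_wpM2r//.
  by have := half_dist e0 w0; rewrite -quarter_sq// expr2.
rewrite -/(K x) /M /=; move: GK; rewrite {1}/K -/q /=; lra.
Qed.

Lemma stable_Gamma2_le phi : stable mu A0 Gamma F u -> A0 phi ->
  (\int[mu]_x ((Gamma2 Gamma L u u x - Gamma_sqrt Gamma w x) * phi x ^+ 2)%:E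
   <= \int[mu]_x (w x * Gamma phi phi x)%:E)%E.
Proof.
move=> st A0phi.
rewrite [leRHS]EFin_Rintegral; last first.
  have A0q := A_A0_mul EA A_Gamma_sol (Gamma_A0 DT A0phi A0phi).
  apply: eq_integrable (A0_integrable DT A0q) => //.
  by move=> x _ /=; rewrite mulrC.
apply/lee_addgt0Pr => e e0.
set K := (\int[mu]_x `|- 2^-1 * L (phi \* phi) x
   + (-1 * (derive1 F (u x) * (phi \* phi) x) + Gamma phi phi x)|)%R.
(* [K] may be 0, hence the error is taken to be [e / (K + 1)]. *)
have K1 : 0 < K + 1 by rewrite ltr_wpDl// Rintegral_ge0.
apply: le_trans (stable_approx st A0phi (divr_gt0 e0 K1)) _.
rewrite -/K -EFinD lee_fin addrC lerD2l mulrAC ler_pdivrMr//.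
rewrite ler_wpM2l ?(ltW e0)//.
by rewrite lerDl.
Qed.

End stable_solutions.

Unset Implicit Arguments.
Set Strict Implicit.

Theorem theorem2p7 (R : realType) (X : ptopologicalType)
    (mu : {measure set (borel X) -> \bar R})
    (A0 A : set (borel X -> R))
    (Gamma : (borel X -> R) -> (borel X -> R) -> borel X -> R)
    (L : (borel X -> R) -> borel X -> R)
    (F : R -> R) (u : borel X -> R) :
  polish R X ->
  sigma_finite [set: borel X] mu ->
  full_support mu ->
  diffusion_triple mu A0 Gamma L ->
  extended_algebra mu A0 A Gamma L ->
  smooth F ->
  weak_solution mu A0 A Gamma F u ->
  stable mu A0 Gamma F u ->
  forall phi : borel X -> R, A0 phi ->
    (\int[mu]_x ((Gamma2 Gamma L u u x - Gamma_sqrt Gamma (Gamma u u) x)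
                 * phi x ^+ 2)%:E
     <= \int[mu]_x (Gamma u u x * Gamma phi phi x)%:E)%E.
Proof.
move=> _ _ _ DT EA sF sol st phi A0phi.
exact: (stable_Gamma2_le DT EA sF sol st A0phi).
Qed.
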